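(* Let $f$ be any function with property $P^{\ast}$ and let $n\geq 6$. Among all bicyclic graphs of order $n$, $B_1$ is the unique graph with the largest value of $\rho(A_f(\cdot))$; i.e. $\rho(A_f(G))<\rho(A_f(B_1))$ for every bicyclic graph $G\not\cong B_1$ of order $n$.
   Context: All graphs are simple and connected; $d_i$ is the degree of $v_i$. A function $f(x,y)$ (positive, symmetric, twice differentiable in $x$) has property $P^{\ast}$ if $f>0$, $f'_x\geq 0$, $f''_x\geq 0$, and whenever $x_1+y_1=x_2+y_2$ and $|x_1-y_1|>|x_2-y_2|$ we have $f(x_1,y_1)\geq f(x_2,y_2)$. $A_f(G)$ has $(i,j)$-entry $f(d_i,d_j)$ if $v_iv_j\in E(G)$ and $0$ otherwise; $\rho(A_f(G))$ is its largest eigenvalue. A bicyclic graph is a connected graph with $|E|=|V|+1$. $B_1$ is the graph of order $n$ obtained from $K_4$ minus an edge (the diamond) by attaching $n-4$ pendant vertices to one of its two degree-3 vertices (equivalently, the star $S_n$ with two edges added between leaves sharing a common leaf). *)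

(* Defs.v *)
From HB Require Import structures.
From mathcomp Require Import all_boot all_order all_fingroup all_algebra.
From mathcomp Require Import boolp classical_sets reals topology normedtype derive.
Set Implicit Arguments. Unset Strict Implicit. Unset Printing Implicit Defensive.
Import Order.TTheory GRing.Theory Num.Theory.
Import numFieldNormedType.Exports.
Local Open Scope ring_scope.
Local Open Scope classical_set_scope.

Definition simple_graph (n : nat) (e : rel 'I_n) : Prop :=
  symmetric e /\ irreflexive e.

Definition connected_graph (n : nat) (e : rel 'I_n) : Prop :=
  forall x y : 'I_n, connect e x y.

Definition edges (n : nat) (e : rel 'I_n) : {set 'I_n * 'I_n} :=
  [set p : 'I_n * 'I_n | e p.1 p.2 & (p.1 < p.2)%N].

Definition bicyclic (n : nat) (e : rel 'I_n) : Prop :=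
  simple_graph e /\ connected_graph e /\ #|edges e| = n.+1.

Definition deg (n : nat) (e : rel 'I_n) (x : 'I_n) : nat := #|[set y | e x y]|.

Definition isomorphic (n : nat) (e1 e2 : rel 'I_n) : Prop :=
  exists h : {perm 'I_n}, forall x y, e2 (h x) (h y) = e1 x y.

(* B_1: diamond on {0,1,2,3} (K4 minus the edge 23), with n-4 pendant
   vertices 4..n-1 attached to the degree-3 vertex 0. Equivalently: the star
   centered at 0 plus the edges 12 and 13. *)
Definition B1 (n : nat) : rel 'I_n := fun x y =>
  let a := val x in let b := val y in
  (a != b) && [|| a == 0%N, b == 0%N,
                (a == 1%N) && ((b == 2%N) || (b == 3%N)) |
                (b == 1%N) && ((a == 2%N) || (a == 3%N))].

Definition Af (R : realType) (f : R -> R -> R) (n : nat) (e : rel 'I_n)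
  : 'M[R]_n :=
  \matrix_(i, j) (if e i j then f (deg e i)%:R (deg e j)%:R else 0).

(* Largest eigenvalue: supremum of the (finitely many) real eigenvalues. *)
Definition rho (R : realType) (n : nat) (A : 'M[R]_n) : R :=
  sup [set a : R | eigenvalue A a].

(* Property P* (on the positive reals, where degrees live). *)
Definition propP (R : realType) (f : R -> R -> R) : Prop :=
  (forall x y, 0 < x -> 0 < y -> 0 < f x y) /\
  (forall x y, 0 < x -> 0 < y -> f x y = f y x) /\
  (forall y x : R, 0 < y -> 0 < x ->
     derivable (fun t : R => f t y) x 1 /\
     derivable (derive1 (fun t : R => f t y)) x 1 /\
     0 <= derive1 (fun t : R => f t y) x /\
     0 <= derive1 (derive1 (fun t : R => f t y)) x) /\
  (forall x1 y1 x2 y2, 0 < x1 -> 0 < y1 -> 0 < x2 -> 0 < y2 ->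
     x1 + y1 = x2 + y2 -> `|x1 - y1| > `|x2 - y2| -> f x1 y1 >= f x2 y2).

(* Main.v *)
(** Let u, v be two vertices that are adjacent or have a common neighbour. The
    Kelmans operation gives u the neighbourhood N(u) ∩ N(v) and v the
    neighbourhood N(u) ∪ N(v), up to the edge uv; it keeps the graph connected
    and preserves the number of edges and all degrees but those of u and v.
    If x is the Perron vector of A_f(G), with x_u <= x_v, then monotonicity,
    convexity and the spread condition on f show that the Rayleigh quotient at
    x does not decrease; if neither of N(u), N(v) contains the other, then x is
    no longer an eigenvector for the same eigenvalue, so rho strictly increases.
    In a bicyclic graph of maximal rho such pairs are therefore nested. Then a
    vertex of maximal degree is dominating, and the two edges avoiding it share
    a vertex, which is B_1. *)
Require Import Defs.
From HB Require Import structures.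
From mathcomp Require Import all_boot all_order all_fingroup all_algebra.
From mathcomp Require Import boolp classical_sets reals topology normedtype derive.
From mathcomp Require Import ring lra zify.
Set Implicit Arguments.
Unset Strict Implicit.
Unset Printing Implicit Defensive.
Import Order.TTheory GRing.Theory Num.Theory.
Import numFieldNormedType.Exports.
Local Open Scope ring_scope.

(** * Calculus on the positive half-line *)

Section Monotone.
Variables (R : realType) (g : R -> R).
Hypothesis dg : forall x, 0 < x -> derivable g x 1.

Lemma pos_MVT (a b : R) : 0 < a -> a <= b ->
  exists2 c, a <= c <= b & g b - g a = derive1 g c * (b - a).
Proof.
move=> a0 ab.
have [||c] := @MVT_segment R g (derive1 g) a b ab.
- move=> x; rewrite in_itv /= => /andP[ax _].
  rewrite derive1E; apply: DeriveDef => //; exact: dg (lt_trans a0 ax).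
- apply: derivable_within_continuous => x; rewrite in_itv /= => /andP[ax _].
  exact: dg (lt_le_trans a0 ax).
by rewrite in_itv /= => cab e; exists c.
Qed.

Hypothesis dg_ge0 : forall x, 0 < x -> 0 <= derive1 g x.

Lemma pos_derive1_homo (a b : R) : 0 < a -> a <= b -> g a <= g b.
Proof.
move=> a0 ab; have [c /andP[ac _] e] := pos_MVT a0 ab.
by rewrite -subr_ge0 e mulr_ge0 ?subr_ge0 ?dg_ge0 ?(lt_le_trans a0 ac).
Qed.
End Monotone.

(** Two increments of the same length [k] are compared, one from [p], one from [p + l]. With
    [k <= l] the first interval lies to the left of the second, so the mean-value points are ordered
    and [derive1 g] is monotone between them. *)
Lemma pos_convex_spread (R : realType) (g : R -> R) :
  (forall x, 0 < x -> derivable g x 1) ->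
  (forall x, 0 < x -> derivable (derive1 g) x 1) ->
  (forall x, 0 < x -> 0 <= derive1 (derive1 g) x) ->
  forall p k l, 0 < p -> 0 <= k -> 0 <= l ->
  g (p + k) + g (p + l) <= g p + g (p + k + l).
Proof.
move=> d1 d2 d2ge p k l p0.
wlog kl : k l / k <= l => [H|k0 l0].
  case: (leP k l) => [|/ltW] kl k0 l0; first exact: H.
  by have := H l k kl l0 k0; rewrite addrAC [X in X <= _]addrC.
have [||c1 /andP[c1a c1b] e1] := @pos_MVT R g d1 p (p + k); [lra|lra|].
have [||c2 /andP[c2a c2b] e2] := @pos_MVT R g d1 (p + l) (p + l + k); [lra|lra|].
have h : derive1 g c1 <= derive1 g c2 by apply: pos_derive1_homo => //; lra.
have : derive1 g c1 * k <= derive1 g c2 * k by apply: ler_wpM2r.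
rewrite (_ : p + k + l = p + l + k); last lra.
rewrite (_ : p + k - p = k) in e1; last lra.
rewrite (_ : p + l + k - (p + l) = k) in e2; last lra.
by lra.
Qed.

Lemma continuous_sumr (R : realType) (T : topologicalType) (I : finType)
    (F : I -> T -> R) :
  (forall i, continuous (F i)) -> continuous (fun x => \sum_i F i x).
Proof.
move=> Fc; apply: (@continuous_big R I +%R 0 xpredT); last by move=> i _; exact: Fc.
exact: (@pseudometric_normed_Zmodule.add_continuous R R^o).
Qed.

(** * Rayleigh quotients and Perron vectors *)

Section Rayleigh.
Variables (R : realType) (n : nat).
Implicit Types (A : 'M[R]_n) (x y : 'rV[R]_n).

Definition bform A x y : R := (x *m A *m y^T) 0 0.
Definition dot x y : R := (x *m y^T) 0 0.

Lemma dotE x y : dot x y = \sum_i x 0 i * y 0 i.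
Proof. by rewrite /dot mxE; apply: eq_bigr => i _; rewrite mxE. Qed.

Lemma bformE A x y : bform A x y = \sum_i \sum_j x 0 i * A i j * y 0 j.
Proof.
rewrite /bform mxE exchange_big; apply: eq_bigr => j _.
by rewrite !mxE mulr_suml.
Qed.

Lemma dot_ge0 x : 0 <= dot x x.
Proof. by rewrite dotE sumr_ge0 // => i _; rewrite -expr2 sqr_ge0. Qed.

Lemma dot_eq0 x : dot x x = 0 -> x = 0.
Proof.
rewrite dotE => /eqP; rewrite psumr_eq0 => [/allP x0|i _]; last first.
  by rewrite -expr2 sqr_ge0.
apply/rowP => i; rewrite mxE; apply/eqP.
by have := x0 i (mem_index_enum i); rewrite /= mulf_eq0 orbb.
Qed.

Lemma dot_gt0 x : x != 0 -> 0 < dot x x.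
Proof.
by move=> xn0; rewrite lt_neqAle dot_ge0 eq_sym andbT; apply: contraNneq xn0 => /dot_eq0->.
Qed.

Lemma dotZ c x y : dot (c *: x) y = c * dot x y.
Proof. by rewrite /dot -scalemxAl mxE. Qed.

Lemma dotC x y : dot x y = dot y x.
Proof. by rewrite !dotE; apply: eq_bigr => i _; rewrite mulrC. Qed.

Lemma dotDl x y z : dot (x + y) z = dot x z + dot y z.
Proof. by rewrite /dot mulmxDl mxE. Qed.

Lemma dotDr x y z : dot x (y + z) = dot x y + dot x z.
Proof. by rewrite dotC dotDl !(dotC _ x). Qed.

Lemma dotZr c x y : dot x (c *: y) = c * dot x y.
Proof. by rewrite dotC dotZ dotC. Qed.

Lemma bformZl A c x y : bform A (c *: x) y = c * bform A x y.
Proof. by rewrite /bform -!scalemxAl mxE. Qed.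

Lemma bformZr A c x y : bform A x (c *: y) = c * bform A x y.
Proof. by rewrite /bform linearZ /= -scalemxAr mxE. Qed.

Lemma bformDl A x y z : bform A (x + y) z = bform A x z + bform A y z.
Proof. by rewrite /bform !mulmxDl mxE. Qed.

Lemma bformDr A x y z : bform A x (y + z) = bform A x y + bform A x z.
Proof. by rewrite /bform linearD mulmxDr mxE. Qed.

Lemma bformC A x y : A^T = A -> bform A x y = bform A y x.
Proof.
move=> symA; rewrite /bform -[in LHS]symA -[x in LHS]trmxK.
by rewrite -!trmx_mul -mulmxA mxE mulmxA.
Qed.

Lemma bformZ A c x : bform A (c *: x) (c *: x) = c ^+ 2 * bform A x x.
Proof. by rewrite bformZl bformZr mulrA. Qed.

Lemma rayleigh_max A : (0 < n)%N ->
  exists2 x, dot x x = 1 & forall y, bform A y y <= bform A x x * dot y y.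
Proof.
move=> n0; pose S : set 'rV[R]_n := [set x | dot x x = 1]%classic.
pose i0 := Ordinal n0.
have S0 : (S !=set0)%classic.
  exists (delta_mx 0 i0); rewrite /S /= dotE (bigD1 i0) //= big1 => [|i /negbTE ni].
    by rewrite mxE !eqxx mulr1 addr0.
  by rewrite !mxE ni andbF mul0r.
have cc i : continuous (fun x : 'rV[R]_n => x 0 i) by exact: coord_continuous.
have Scl : closed S.
  apply: (@preimage_closed _ _ (fun x => dot x x) [set y | y = 1]%classic);
    last exact: closed_eq.
  rewrite (_ : (fun x => dot x x) = fun x => \sum_i x 0 i * x 0 i); last first.
    by apply/funext => x; exact: dotE.
  move=> x _; apply: continuous_sumr => i y.
  by apply: continuousM; apply: cc.
(* The Euclidean unit sphere is closed and lies in the compact cube with sides [-1, 1]. *)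
have Sc : compact S.
  have Bc : compact [set v : 'rV[R]_n | forall i, `[(-1), 1]%classic (v ord0 i)]%classic.
    have := @rV_compact R n (fun=> `[(-1), 1]%classic).
    by apply=> _; exact: segment_compact.
  apply: subclosed_compact Scl Bc _ => x /= x1 i.
  rewrite in_itv /= -ler_norml -(@expr_le1 _ 2) // real_normK ?num_real //.
  rewrite -x1 dotE (bigD1 i) //= -expr2 lerDl sumr_ge0 // => j _.
  by rewrite -expr2 sqr_ge0.
have fc : {within S, continuous (fun x => bform A x x)}%classic.
  apply: continuous_subspaceT.
  rewrite (_ : (fun x => _) = fun x => \sum_i \sum_j x 0 i * A i j * x 0 j); last first.
    by apply/funext => x; exact: bformE.
  apply: continuous_sumr => i; apply: continuous_sumr => j z.
  apply: (@continuousM R _ (fun x : 'rV[R]_n => x 0 i * A i j) (fun x => x 0 j));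
    last exact: cc.
  apply: (@continuousM R _ (fun x : 'rV[R]_n => x 0 i)); first exact: cc.
  exact: cst_continuous.
have [x] := EVT_max_rV S0 Sc fc.
rewrite inE => x1 xmax; exists x => // y.
have [->|yn0] := eqVneq y 0.
  by rewrite /bform /dot !mul0mx !mxE mulr0.
have y0 := dot_gt0 yn0.
pose s := Num.sqrt (dot y y).
have s2 : s ^+ 2 = dot y y by rewrite sqr_sqrtr // ltW.
have sn0 : s != 0 by rewrite sqrtr_eq0 -ltNge.
have /xmax : s^-1 *: y \in S.
  by rewrite inE /S /= dotZ dotC dotZ -s2 expr2 mulKf // mulVf.
by rewrite bformZ exprVn s2 ler_pdivrMl // mulrC.
Qed.

(** First variation: moving from [x] along the residual [z] of the eigenvalue equation gains a term
    linear in the step, which the quadratic terms cannot offset for small steps unless [z]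
    vanishes. *)
Lemma rayleigh_eigenvector A x : A^T = A ->
  (forall y, bform A y y <= bform A x x * dot y y) -> dot x x = 1 ->
  x *m A = bform A x x *: x.
Proof.
move=> symA xmax x1; apply/eqP; rewrite -subr_eq0; apply/eqP.
set l := bform A x x in xmax *.
have [z zE] : exists z, z = x *m A - l *: x by eexists.
rewrite -zE.
have [s0|s0] := eqVneq (dot z z) 0; first exact: dot_eq0.
have {}s0 : 0 < dot z z by rewrite lt_neqAle eq_sym s0 dot_ge0.
pose K := l * dot z z - bform A z z.
have K0 : 0 <= K by rewrite subr_ge0 xmax.
have key t : 2 * t * dot z z <= t ^+ 2 * K.
  have := xmax (x + t *: z).
  have -> : dot (x + t *: z) (x + t *: z) = 1 + 2 * t * dot x z + t ^+ 2 * dot z z.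
    by rewrite !dotDl !dotDr !dotZ !dotZr [dot z x]dotC x1; ring.
  have -> : bform A (x + t *: z) (x + t *: z) =
      l + 2 * t * bform A x z + t ^+ 2 * bform A z z.
    by rewrite !bformDl !bformDr !bformZl !bformZr [bform _ z x]bformC // -/l; ring.
  have -> : bform A x z = l * dot x z + dot z z.
    rewrite -dotZ -dotDl; congr (dot _ z); by rewrite zE addrC subrK.
  by rewrite /K; lra.
clear zE; have K1 : 0 < K + 1 by lra.
(* Any small positive step would do. Dividing by [K + 1] allows [K = 0], and leaves the excess
   [t ^+ 2 * (K + 2)], which is positive. *)
have := key (dot z z / (K + 1)); set s := dot z z in s0 *.
have sK : 0 < (s / (K + 1)) ^+ 2 * (K + 2).
  by rewrite mulr_gt0 ?exprn_gt0 ?divr_gt0 // ltr_wpDl.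
have dE : 2 * (s / (K + 1)) * s - (s / (K + 1)) ^+ 2 * K = (s / (K + 1)) ^+ 2 * (K + 2).
  by field; rewrite gt_eqF.
by move: sK; rewrite -dE subr_gt0 ltNge => /negbTE->.
Qed.

(** Evaluating the form at an eigenvector for [a] gives [a <= l], so the supremum is attained at
    [l]. *)
Lemma rho_eigenvalue A l : eigenvalue A l ->
  (forall y, bform A y y <= l * dot y y) -> rho A = l.
Proof.
move=> el lmax; have ub : ubound [set a : R | eigenvalue A a]%classic l.
  move=> a /= /eigenvalueP[v vA vn0]; rewrite -(ler_pM2r (dot_gt0 vn0)).
  by rewrite -dotZ -vA; exact: lmax.
apply/eqP; rewrite eq_le /rho; apply/andP; split.
  by apply: ge_sup => //; exists l.
by apply: ub_le_sup => //; exists l.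
Qed.

Lemma rho_variational A : (0 < n)%N -> A^T = A ->
  (forall y, bform A y y <= rho A * dot y y) /\
  exists2 x, dot x x = 1 & bform A x x = rho A.
Proof.
move=> n0 symA; have [x x1 xmax] := rayleigh_max A n0.
suff -> : rho A = bform A x x by split => //; exists x.
apply: rho_eigenvalue (xmax) => //; apply/eigenvalueP; exists x.
  exact: rayleigh_eigenvector.
by apply/eqP => x0; move: x1; rewrite x0 /dot mul0mx mxE => /eqP; rewrite eq_sym oner_eq0.
Qed.

Lemma rho_eigenvector A x : A^T = A -> dot x x = 1 ->
  (forall y, bform A y y <= rho A * dot y y) -> bform A x x = rho A ->
  x *m A = rho A *: x.
Proof.
by move=> symA x1 xmax e; rewrite -e; apply: rayleigh_eigenvector => //; rewrite e.
Qed.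

(** Replacing the coordinates of a maximiser by their absolute values keeps the norm and does not
    lower the form, so the result is again a maximiser, hence an eigenvector. *)
Lemma nonneg_eigenvector A : (0 < n)%N -> A^T = A -> (forall i j, 0 <= A i j) ->
  exists x, [/\ dot x x = 1, forall i, 0 <= x 0 i & x *m A = rho A *: x].
Proof.
move=> n0 symA A0; have [rmax [x x1 xr]] := rho_variational n0 symA.
pose y : 'rV[R]_n := \row_i `|x 0 i|.
have y1 : dot y y = 1.
  rewrite -x1 !dotE; apply: eq_bigr => i _; rewrite !mxE -normrM ger0_norm //.
  by rewrite -expr2 sqr_ge0.
have yr : bform A y y = rho A.
  apply/eqP; rewrite eq_le; apply/andP; split; first by rewrite -[leRHS]mulr1 -y1.
  rewrite -xr !bformE; apply: ler_sum => i _; apply: ler_sum => j _.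
  by rewrite !mxE (le_trans (ler_norm _)) // !normrM (ger0_norm (A0 i j)).
exists y; split => [//|i|]; first by rewrite mxE.
exact: rho_eigenvector.
Qed.

Lemma perron_vector A (e : rel 'I_n) : (0 < n)%N -> A^T = A ->
  (forall i j, 0 <= A i j) -> (forall i j, e i j -> 0 < A i j) ->
  connected_graph e ->
  exists x, [/\ dot x x = 1, forall i, 0 < x 0 i & x *m A = rho A *: x].
Proof.
move=> n0 symA A0 Ae ce; have [x [x1 x0 xA]] := nonneg_eigenvector n0 symA A0.
exists x; split => // i; rewrite lt_neqAle x0 andbT eq_sym.
apply/eqP => xi0.
(* A zero coordinate spreads to neighbours: coordinate [a] of the eigenvalue equation is a vanishing
   sum of nonnegative terms. Connectedness then makes [x] zero. *)
have step a b : x 0 a = 0 -> e b a -> x 0 b = 0.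
  move=> xa eba; have := congr1 (fun v : 'rV[R]_n => v 0 a) xA.
  rewrite !mxE xa mulr0 => /eqP; rewrite psumr_eq0 => [/allP H|k _]; last exact: mulr_ge0.
  have := H b (mem_index_enum b); rewrite /= mulf_eq0 (gt_eqF (Ae _ _ eba)) orbF.
  by move/eqP.
have zero b : x 0 b = 0.
  have /connectP[p ep lp] := ce b i.
  elim: p b ep lp => /= [b _ <-//|c p IH b /andP[ebc pp] lp].
  by apply: (step c) => //; apply: IH.
move: x1; rewrite dotE big1 => [/eqP|j _]; last by rewrite zero mul0r.
by rewrite eq_sym oner_eq0.
Qed.

End Rayleigh.

(** * Comparing spectral radii when two rows and columns change *)

Lemma bigID2 (V : nmodType) (I : finType) (u v : I) (G : I -> V) : u != v ->
  \sum_i G i = G u + G v + \sum_(i | (i != u) && (i != v)) G i.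
Proof.
by move=> uv; rewrite (bigD1 u) //= (bigD1 v) 1?eq_sym //= addrA.
Qed.

(** This isolates the linear algebra of the Kelmans step. Weight moved from [u] to [v] meets a
    coordinate of [x] at least as large, so losses in row [u] are covered by gains in row [v]. *)
Lemma rho_lt_perturb (R : realType) (n : nat) (A A' : 'M[R]_n) (x : 'rV[R]_n)
    (u v w : 'I_n) :
  A^T = A -> A'^T = A' ->
  dot x x = 1 -> (forall i, 0 < x 0 i) -> x *m A = rho A *: x ->
  u != v -> x 0 u <= x 0 v ->
  (forall i j, i != u -> i != v -> j != u -> j != v -> A' i j = A i j) ->
  A' u u = A u u -> A' v v = A v v -> A u v <= A' u v ->
  (forall j, j != u -> j != v -> A v j <= A' v j) ->
  (forall j, j != u -> j != v -> A u j + A v j <= A' u j + A' v j) ->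
  A v w < A' v w ->
  rho A < rho A'.
Proof.
move=> sA sA' x1 x0 xA uv xuv Aout Auu Avv Auv Avj Auvj Avw.
have n0 : (0 < n)%N by apply: leq_ltn_trans (ltn_ord u).
have [rmax _] := rho_variational n0 sA'.
have sAE i j : A i j = A j i by rewrite -{1}sA mxE.
have sA'E i j : A' i j = A' j i by rewrite -{1}sA' mxE.
pose D := A' - A.
have sD i j : D i j = D j i by rewrite !mxE sAE sA'E.
have pair_ge0 j : j != u -> j != v -> 0 <= D u j * x 0 u + D v j * x 0 v.
  move=> ju jv; have Dv : 0 <= D v j by rewrite !mxE subr_ge0 Avj.
  have Duv : 0 <= D u j + D v j.
    by have := Auvj j ju jv; rewrite !mxE; lra.
  apply: (@le_trans _ _ ((D u j + D v j) * x 0 u)).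
    by rewrite mulr_ge0 // ltW.
  by rewrite mulrDl lerD2l ler_wpM2l.
have D0 : 0 <= bform D x x.
  rewrite bformE (bigID2 _ uv) /= -big_split /= addr_ge0 //.
    rewrite (bigID2 _ uv) /= !addr_ge0 //.
    - by rewrite mxE [(- A) u u]mxE Auu subrr mulr0 mul0r.
    - by rewrite sD !mulr_ge0 ?(ltW (x0 _)) // !mxE subr_ge0.
    - by rewrite !mulr_ge0 ?(ltW (x0 _)) // !mxE subr_ge0.
    - by rewrite mxE [(- A) v v]mxE Avv subrr mulr0 mul0r.
    - apply: sumr_ge0 => j /andP[ju jv]; rewrite -mulrDl mulr_ge0 ?(ltW (x0 _)) //.
      by rewrite ![x 0 _ * _]mulrC pair_ge0.
  apply: sumr_ge0 => i /andP[iu iv]; rewrite (bigID2 _ uv) /= big1 => [|j /andP[ju jv]].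
    by rewrite addr0 -!mulrA -mulrDr mulr_ge0 ?(ltW (x0 _)) // !(sD i) pair_ge0.
  by rewrite !mxE Aout // subrr mulr0 mul0r.
have A'E : bform A' x x = rho A + bform D x x.
  have -> : rho A = bform A x x by rewrite /bform xA -scalemxAl mxE -/(dot x x) x1 mulr1.
  by rewrite -{1}(subrKC A A') /bform mulmxDr mulmxDl mxE.
have le : rho A <= rho A'.
  by have := rmax x; rewrite x1 mulr1 A'E; lra.
(* In case of equality [x] is a maximiser for [A'] too, so [x *m A = x *m A']. Coordinate [v]
   refutes this: no entry of that column decreases, and the one at [w] grows. *)
rewrite lt_neqAle le andbT; apply/eqP => eqr.
have xr : bform A' x x = rho A'.
  by have := rmax x; rewrite x1 mulr1 A'E; lra.
have := rho_eigenvector sA' x1 rmax xr; rewrite -eqr -xA => xAA'.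
have leD j : A j v <= A' j v.
  rewrite sAE sA'E.
  have [->|ju] := eqVneq j u; first by rewrite sAE sA'E.
  by have [->|jv] := eqVneq j v; [rewrite Avv|exact: Avj].
have := congr1 (fun y : 'rV[R]_n => y 0 v) xAA'; rewrite !mxE => /esym/eqP.
apply/negP; rewrite lt_eqF // (bigD1 w) //= [ltRHS](bigD1 w) //=.
apply: ltr_leD; last by apply: ler_sum => j _; rewrite ler_wpM2l // ltW.
by rewrite ltr_pM2l // sAE sA'E.
Qed.

(** * The Kelmans operation on graphs *)

Section Kelmans.
Variables (n : nat) (e : rel 'I_n) (u v : 'I_n).
Hypotheses (sym_e : symmetric e) (irr_e : irreflexive e) (uv : u != v).

(* [kelmans u] is the intersection and [kelmans v] the union of the two
   neighbourhoods; the pair uv itself is left alone. *)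
Definition kelmans : rel 'I_n := fun i j =>
  let P k := (k == u) || (k == v) in
  let t k j := if k == u then e u j && e v j else e u j || e v j in
  if P i == P j then e i j else if P i then t i j else t j i.

Lemma kelmans_out i j : i != u -> i != v -> j != u -> j != v ->
  kelmans i j = e i j.
Proof. by rewrite /kelmans => /negbTE-> /negbTE-> /negbTE-> /negbTE->. Qed.

Lemma kelmans_sym : symmetric kelmans.
Proof.
move=> i j; rewrite /kelmans eq_sym sym_e; case: eqP => // /eqP.
by case: ((i == u) || _); case: ((j == u) || _).
Qed.

Lemma kelmans_irr : irreflexive kelmans.
Proof. by move=> i; rewrite /kelmans eqxx. Qed.

Lemma kelmans_uv : kelmans u v = e u v.
Proof. by rewrite /kelmans !eqxx orbT. Qed.

Lemma kelmans_u j : j != u -> j != v -> kelmans u j = e u j && e v j.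
Proof. by rewrite /kelmans => /negbTE-> /negbTE->; rewrite !eqxx. Qed.

Lemma kelmans_v j : j != u -> j != v -> kelmans v j = e u j || e v j.
Proof.
by rewrite /kelmans => /negbTE-> /negbTE->; rewrite eqxx orbT [v == u]eq_sym (negbTE uv).
Qed.

Lemma degE (e1 : rel 'I_n) i : deg e1 i = \sum_j (e1 i j : nat).
Proof.
transitivity #|[pred j | e1 i j]|; last by rewrite -sum1_card big_mkcond.
by apply: eq_card => j; apply/idP/idP; rewrite !inE.
Qed.

Lemma deg_gt0 (e1 : rel 'I_n) i j : e1 i j -> (0 < deg e1 i)%N.
Proof. by move=> eij; apply/card_gt0P; exists j; rewrite inE. Qed.

Lemma deg_kelmans_out i : i != u -> i != v -> deg kelmans i = deg e i.
Proof.
move=> iu iv; rewrite !degE !(bigID2 _ uv) /=; congr (_ + _).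
  rewrite !(kelmans_sym i) kelmans_u // kelmans_v // !(sym_e i).
  by case: (e u i); case: (e v i).
by apply: eq_bigr => j /andP[ju jv]; rewrite kelmans_out.
Qed.

(** Here [p] counts the common neighbours, plus one if uv is an edge, while [k] and [l] count the
    private neighbours of [u] and [v] outside the pair. The operation hands all private neighbours
    to [v]. *)
Lemma deg_kelmans_pair : exists p k l : nat,
  [/\ deg e u = (p + k)%N, deg e v = (p + l)%N, deg kelmans u = p,
      deg kelmans v = (p + k + l)%N &
      (forall w, e u w -> ~~ e v w -> w != v -> (0 < k)%N) /\
      (forall z, e v z -> ~~ e u z -> z != u -> (0 < l)%N)].
Proof.
pose Q (j : 'I_n) := (j != u) && (j != v).
exists (e u v + \sum_(j | Q j) (e u j && e v j))%N.
exists (\sum_(j | Q j) (e u j && ~~ e v j))%N.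
exists (\sum_(j | Q j) (e v j && ~~ e u j))%N.
rewrite !degE !(bigID2 _ uv) /= !kelmans_irr !irr_e (kelmans_sym v) kelmans_uv (sym_e v).
rewrite !add0r !addr0 -!addnA -!big_split /=; split.
- by congr addn; apply: eq_bigr => j _; case: (e u j); case: (e v j).
- by congr addn; apply: eq_bigr => j _; case: (e u j); case: (e v j).
- by congr addn; apply: eq_bigr => j /andP[ju jv]; rewrite kelmans_u.
- congr addn; apply: eq_bigr => j /andP[ju jv]; rewrite kelmans_v //.
  by case: (e u j); case: (e v j).
have pos (B : 'I_n -> bool) w : Q w -> B w -> (0 < \sum_(j | Q j) B j)%N.
  by move=> Qw Bw; rewrite (bigD1 w) //= Bw.
split=> w ew nw wuv; apply: (pos _ w) => /=; rewrite ?ew ?nw // /Q wuv ?andbT //=.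
  by apply: contraTneq ew => ->; rewrite irr_e.
by apply: contraTneq ew => ->; rewrite irr_e.
Qed.

(** Every old edge is replaced by a new path. The edge uv or the common neighbour [c] still joins
    [u] to [v], and any outside neighbour of [u] or [v] is now adjacent to [v]. *)
Lemma connected_kelmans : connected_graph e ->
  (e u v \/ exists c, e u c && e v c) -> connected_graph kelmans.
Proof.
move=> ce near.
have cs : connect_sym kelmans by apply: sym_connect_sym kelmans_sym.
have cuv : connect kelmans u v.
  case: near => [euv|[c /andP[uc vc]]]; first by rewrite connect1 // kelmans_uv.
  have cu : c != u by apply: contraTneq uc => ->; rewrite irr_e.
  have cv : c != v by apply: contraTneq vc => ->; rewrite irr_e.
  apply: (@connect_trans _ _ c); rewrite connect1 //.
    by rewrite kelmans_u ?uc.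
  by rewrite kelmans_sym kelmans_v ?uc.
have half k j : (k == u) || (k == v) -> j != u -> j != v -> e k j -> connect kelmans k j.
  move=> kuv ju jv ekj.
  have vj : connect kelmans v j.
    by rewrite connect1 // kelmans_v //; case/orP: kuv ekj => /eqP-> ->; rewrite ?orbT.
  by case/orP: kuv => /eqP-> //; apply: connect_trans vj.
move=> x y; apply: connect_sub (ce x y) => {x y} i j eij.
case Pij : (((i == u) || (i == v)) == ((j == u) || (j == v))).
  by rewrite connect1 // /kelmans Pij.
case Pi : ((i == u) || (i == v)) Pij; case Pj : ((j == u) || (j == v)) => // _.
  by case/norP: (negbT Pj) => ju jv; exact: half.
case/norP: (negbT Pi) => iu iv.
by rewrite cs; apply: half => //; rewrite sym_e.
Qed.

End Kelmans.

(** Turns edge counts into degree sums, both for the Kelmans operation and for the removal of a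
    dominating vertex. *)
Lemma handshake (n : nat) (e : rel 'I_n) : symmetric e -> irreflexive e ->
  (\sum_i deg e i = #|edges e|.*2)%N.
Proof.
move=> sym_e irr_e.
have cardE (P : pred ('I_n * 'I_n)) :
    #|[set p | P p]| = (\sum_i \sum_j (P (i, j) : nat))%N.
  by rewrite cardsE -sum1_card big_mkcond pair_bigA; apply: eq_bigr => -[].
have -> : #|edges e|.*2 =
    (\sum_i \sum_j (e i j && (i < j) : nat) + \sum_i \sum_j (e j i && (j < i) : nat))%N.
  by rewrite -addnn [X in _ = (_ + X)%N]exchange_big /= /edges cardE.
rewrite -big_split; apply: eq_bigr => i _; rewrite degE -big_split.
apply: eq_bigr => j _; rewrite (sym_e j) /=.
by case: ltngtP => [||/val_inj->]; rewrite ?irr_e ?andbT ?andbF ?addn0.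
Qed.

Lemma kelmans_bicyclic (n : nat) (e : rel 'I_n) (u v : 'I_n) :
  bicyclic e -> u != v -> (e u v \/ exists c, e u c && e v c) ->
  bicyclic (kelmans e u v).
Proof.
move=> [[sym_e irr_e] [ce ne]] uv near.
have sym_k := kelmans_sym u v sym_e; have irr_k := kelmans_irr u v irr_e.
split=> //; split; first exact: connected_kelmans.
rewrite -ne; apply/double_inj; rewrite -!handshake //.
rewrite !(bigID2 _ uv) /=.
have [p [k [l [-> -> -> -> _]]]] := deg_kelmans_pair sym_e irr_e uv.
(* The pair contributes p + (p + k + l) after the operation and (p + k) + (p + l) before. *)
congr addn; first by rewrite /GRing.add /=; lia.
by apply: eq_bigr => i /andP[iu iv]; rewrite deg_kelmans_out.
Qed.

(** * The conditions on f and strict improvement *)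

Section PropP.
Variables (R : realType) (f : R -> R -> R).
Hypothesis Pf : propP f.

Lemma propP_gt0 x y : 0 < x -> 0 < y -> 0 < f x y.
Proof. by case: Pf => H _; exact: H. Qed.

Lemma propP_sym x y : 0 < x -> 0 < y -> f x y = f y x.
Proof. by case: Pf => _ [H _]; exact: H. Qed.

Lemma propP_homo a b y : 0 < y -> 0 < a -> a <= b -> f a y <= f b y.
Proof.
case: Pf => _ [_ [H _]] y0; apply: (@pos_derive1_homo R (f^~ y)) => x x0;
  by have [? [? []]] := H y x y0 x0.
Qed.

Lemma propP_convex p k l y : 0 < y -> 0 < p -> 0 <= k -> 0 <= l ->
  f (p + k) y + f (p + l) y <= f p y + f (p + k + l) y.
Proof.
case: Pf => _ [_ [H _]] y0; apply: (@pos_convex_spread R (f^~ y)) => x x0;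
  by have [? [? []]] := H y x y0 x0.
Qed.

(** Both pairs have the same sum, and |k - l| < k + l since [k] and [l] are positive. *)
Lemma propP_spread p k l : 0 < p -> 0 < k -> 0 < l ->
  f (p + k) (p + l) <= f p (p + k + l).
Proof.
case: Pf => _ [_ [_ H]] p0 k0 l0; apply: H; try lra.
have -> : p - (p + k + l) = - (k + l) by lra.
rewrite normrN (ger0_norm (addr_ge0 (ltW k0) (ltW l0))).
by case: (lerP 0 (p + k - (p + l))) => h; rewrite ?(ger0_norm h) ?(ltr0_norm h); lra.
Qed.

Variable n : nat.
Implicit Type e : rel 'I_n.

Lemma Af_sym e : symmetric e -> (Af f e)^T = Af f e.
Proof.
move=> sym_e; apply/matrixP => i j; rewrite !mxE sym_e.
case: ifP => // eij; rewrite propP_sym // ltr0n.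
  by apply: deg_gt0; rewrite sym_e; exact: eij.
exact: deg_gt0 eij.
Qed.

Lemma Af_gt0 e i j : symmetric e -> e i j -> 0 < Af f e i j.
Proof.
move=> sym_e eij; rewrite mxE eij propP_gt0 // ltr0n ?(deg_gt0 eij) //.
by rewrite sym_e in eij; apply: deg_gt0 eij.
Qed.

Lemma Af_ge0 e i j : symmetric e -> 0 <= Af f e i j.
Proof.
move=> sym_e; case eij: (e i j); first by rewrite ltW // Af_gt0.
by rewrite mxE eij.
Qed.

Lemma kelmans_improves e (u v : 'I_n) : bicyclic e -> u != v ->
  (e u v \/ exists c, e u c && e v c) ->
  (exists w, [&& e u w, ~~ e v w & w != v]) ->
  (exists z, [&& e v z, ~~ e u z & z != u]) ->
  exists e', bicyclic e' /\ rho (Af f e) < rho (Af f e').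
Proof.
move=> be; have [[sym_e irr_e] [ce _]] := be.
move=> uv near Hw Hz.
have n0 : (0 < n)%N by apply: leq_ltn_trans (ltn_ord u).
have [x [x1 x0 xA]] := perron_vector n0 (Af_sym sym_e) (fun i j => Af_ge0 i j sym_e)
  (fun i j => @Af_gt0 e i j sym_e) ce.
(* The assumptions are symmetric in [u] and [v], so the vertex with the larger Perron coordinate may
   be the one that receives the neighbours. *)
wlog le_x : u v uv near Hw Hz / x 0 u <= x 0 v.
  move=> H; case: (leP (x 0 u) (x 0 v)) => [|/ltW] le_x; first exact: (H u v).
  apply: (H v u) => //; first by rewrite eq_sym.
  by case: near => [|[c]]; [rewrite sym_e; left|rewrite andbC; right; exists c].
exists (kelmans e u v); split; first exact: kelmans_bicyclic.
have sym_k := kelmans_sym u v sym_e; have irr_k := kelmans_irr u v irr_e.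
have [p [k [l [du dv du' dv' [k0 l0]]]]] := deg_kelmans_pair sym_e irr_e uv.
have {Hz}l0 : (0 < l)%N by case: Hz => z /and3P[]; exact: l0.
case: Hw => w /and3P[uw vw wv]; have {}k0 := k0 w uw vw wv.
have wu : w != u by apply: contraTneq uw => ->; rewrite irr_e.
have dout i : i != u -> i != v -> deg (kelmans e u v) i = deg e i.
  exact: deg_kelmans_out.
have dj0 i j : e i j -> 0 < (deg e j)%:R :> R.
  by rewrite sym_e ltr0n; exact: deg_gt0.
have k0R : 0 < k%:R :> R by rewrite ltr0n.
have l0R : 0 < l%:R :> R by rewrite ltr0n.
have p0R j : e u j -> e v j -> j != u -> j != v -> 0 < p%:R :> R.
  by move=> uj vj ju jv; rewrite ltr0n -du' (@deg_gt0 _ _ _ j) // kelmans_u ?uj.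
have pl0 j : e v j -> 0 < p%:R + l%:R :> R.
  by move=> vj; rewrite -natrD ltr0n -dv; exact: deg_gt0 vj.
have pk0 j : e u j -> 0 < p%:R + k%:R :> R.
  by move=> uj; rewrite -natrD ltr0n -du; exact: deg_gt0 uj.
apply: (@rho_lt_perturb R n _ _ x u v w) => //; try exact: Af_sym.
- by move=> i j iu iv ju jv; rewrite !mxE kelmans_out // !dout.
- by rewrite !mxE irr_e irr_k.
- by rewrite !mxE irr_e irr_k.
(* Entry uv: the spread condition applies, with [p] positive because the edge uv survives. *)
- rewrite !mxE kelmans_uv du dv du' dv' !natrD; case: ifP => // euv.
  apply: propP_spread => //; rewrite ltr0n -du'.
  by apply: (@deg_gt0 _ _ _ v); rewrite kelmans_uv.
- move=> j ju jv; rewrite !mxE kelmans_v // dv dv' dout // !natrD.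
  case vj: (e v j); first rewrite orbT.
    by apply: propP_homo; [exact: dj0 vj|exact: pl0 vj|lra].
  rewrite orbF; case: ifP => // uj; apply/ltW/propP_gt0; last exact: dj0 uj.
  by have := pk0 j uj; lra.
(* Sum of the entries uj and vj: convexity handles a common neighbour, monotonicity a private one,
   whose edge now ends at a vertex of degree p + k + l. *)
- move=> j ju jv; rewrite !mxE kelmans_v // kelmans_u // du dv du' dv' dout // !natrD.
  case uj: (e u j); case vj: (e v j) => //=.
  + by apply: propP_convex; [exact: dj0 uj|exact: (p0R j)|exact: ltW|exact: ltW].
  + rewrite addr0 add0r; apply: propP_homo; [exact: dj0 uj|exact: pk0 uj|lra].
  + rewrite !add0r; apply: propP_homo; [exact: dj0 vj|exact: pl0 vj|lra].
(* The edge vw is new, so its entry rises from zero to a positive value. *)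
- rewrite !mxE kelmans_v // (negbTE vw) uw /= dv' dout // !natrD.
  by apply: propP_gt0; [have := pk0 w uw; lra|exact: dj0 uw].
Qed.

End PropP.

(** * Isomorphism invariance and relabelling *)

Lemma rho_isomorphic (R : realType) (f : R -> R -> R) (n : nat) (e1 e2 : rel 'I_n) :
  isomorphic e1 e2 -> rho (Af f e1) = rho (Af f e2).
Proof.
move=> [h he]; have degh x : deg e2 (h x) = deg e1 x.
  by rewrite !degE (reindex_inj (@perm_inj _ h)); apply: eq_bigr => j _; rewrite he.
have AE i j : Af f e2 (h i) (h j) = Af f e1 i j by rewrite !mxE he !degh.
rewrite /rho; congr sup; apply/seteqP; split=> a /= /eigenvalueP[v va vn0];
  apply/eigenvalueP.
- exists (\row_j v 0 ((h^-1)%g j)).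
    apply/rowP => j; rewrite mxE [RHS]mxE [X in a * X]mxE (reindex_inj (@perm_inj _ h)) /=.
    have := congr1 (fun v : 'rV[R]_n => v 0 ((h^-1)%g j)) va; rewrite mxE [RHS]mxE => <-.
    by apply: eq_bigr => i _; rewrite [X in X * _ = _]mxE permK -AE permKV.
  apply: contraNneq vn0 => v0; apply/eqP/rowP => j.
  by have := congr1 (fun v : 'rV[R]_n => v 0 (h j)) v0; rewrite !mxE permK.
- exists (\row_j v 0 (h j)).
    apply/rowP => j; rewrite mxE [RHS]mxE [X in a * X]mxE.
    have := congr1 (fun v : 'rV[R]_n => v 0 (h j)) va; rewrite mxE [RHS]mxE => <-.
    rewrite [RHS](reindex_inj (@perm_inj _ h)) /=.
    by apply: eq_bigr => i _; rewrite [X in X * _ = _]mxE AE.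
  apply: contraNneq vn0 => v0; apply/eqP/rowP => j.
  by have := congr1 (fun v : 'rV[R]_n => v 0 ((h^-1)%g j)) v0; rewrite !mxE permKV.
Qed.

(** A permutation matching the tails is corrected by a transposition that fixes the heads and leaves
    the tail of [t] alone. It serves to extend a labelling of four vertices to all of them. *)
Lemma perm_map_seq (T : finType) (s t : seq T) :
  uniq s -> uniq t -> size s = size t -> exists h : {perm T}, map h s = t.
Proof.
elim: s t => [|x s IH] [|y t] //=; first by exists 1%g.
move=> /andP[xs us] /andP[yt ut] [st]; have [h ht] := IH t us ut st.
exists (h * tperm (h x) y)%g; rewrite permM tpermL; congr (_ :: _).
rewrite -ht; apply/eq_in_map => z zs; rewrite permM tpermD //.
  by rewrite (inj_eq perm_inj); apply: contraNneq xs => ->.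
by apply: contraNneq yt => ->; rewrite -ht map_f.
Qed.

(** * Structure of graphs with nested neighbourhoods *)

(** Rules out the configuration that [kelmans_improves] needs: [u] and [v] may not both have private
    neighbours outside the pair. *)
Definition nested_pairs (n : nat) (e : rel 'I_n) : Prop :=
  forall u v, u != v -> (e u v \/ exists c, e u c && e v c) ->
  forall w z, e u w -> ~~ e v w -> w != v -> e v z -> e u z || (z == u).

Lemma nested_dominating (n : nat) (e : rel 'I_n) :
  (0 < n)%N -> symmetric e -> irreflexive e -> connected_graph e ->
  nested_pairs e -> exists c, forall y, y != c -> e c y.
Proof.
move=> n0 sym_e irr_e ce ne.
pose c := [arg max_(i > Ordinal n0) deg e i].
have cmax y : (deg e y <= deg e c)%N.
  by rewrite /c; case: arg_maxnP => // i _; apply.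
have degN x : deg e x = #|finset (e x)|.
  by rewrite degE cardsE -sum1_card [RHS]big_mkcond.
(* The closed neighbourhood of [c] is stable under adjacency. If [b] escaped through [a], it would
   be private to [a], so nestedness would make [a] adjacent to [c], to [b] and to all other
   neighbours of [c]: one more than the maximal degree. *)
have closed_step a b : e a b -> (a == c) || e c a -> (b == c) || e c b.
  move=> eab /predU1P[<-|eca]; first by rewrite eab orbT.
  apply/negPn/negP; rewrite negb_or => /andP[bc ncb].
  have ca : c != a by apply: contraTneq eca => <-; rewrite irr_e.
  have sub : c |: (b |: finset (e c) :\ a) \subset finset (e a).
    apply/fintype.subsetP => w; rewrite !inE => /predU1P[->|/predU1P[->//|/andP[wa cw]]].
      by rewrite sym_e.
    apply: contraNT ncb => naw.
    have := ne c a ca (or_introl eca) w b cw naw wa eab.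
    by rewrite (negbTE bc) orbF.
  have := subset_leq_card sub; rewrite -degN leqNgt => /negP; apply.
  rewrite (leq_ltn_trans (cmax a)) // degN (cardsD1 a) inE eca !cardsU1 !inE.
  by rewrite (negbTE ncb) irr_e !andbF !orbF eq_sym bc.
have reach p a : path e a p -> (a == c) || e c a -> (last a p == c) || e c (last a p).
  by elim: p a => //= b p IH a /andP[eab pb] ca; exact: IH pb (closed_step _ _ eab ca).
exists c => y yc; have /connectP[p ep ly] := ce c y.
by have := reach p c ep; rewrite -ly eqxx (negbTE yc); apply.
Qed.

Lemma nested_isomorphic_B1 (n : nat) (e : rel 'I_n) :
  (4 <= n)%N -> bicyclic e -> nested_pairs e -> isomorphic e (@B1 n).
Proof.
move=> n4 [[sym_e irr_e] [ce ne]] nest.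
have n0 : (0 < n)%N by lia.
have [c dom] := nested_dominating n0 sym_e irr_e ce nest.
(* The graph without its dominating vertex, with [c] kept as an isolated point. *)
pose e0 : rel 'I_n := fun x y => [&& e x y, x != c & y != c].
have sym0 : symmetric e0 by move=> x y; rewrite /e0 sym_e [(x != c) && _]andbC.
have irr0 : irreflexive e0 by move=> x; rewrite /e0 irr_e.
have degc : deg e c = n.-1.
  rewrite degE (bigD1 c) //= irr_e add0r (eq_bigr (fun=> 1%N)) => [|y yc];
    last by rewrite dom.
  by rewrite sum1_card cardC1 card_ord.
have deg0c : deg e0 c = 0%N.
  by rewrite degE big1 // => y _; rewrite /e0 eqxx andbF.
have deg0 i : i != c -> deg e i = (deg e0 i).+1.
  move=> ic; rewrite !degE (bigD1 c) //= [in RHS](bigD1 c) //=.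
  rewrite /e0 sym_e dom // eqxx !andbF add0r; congr _.+1.
  by apply: eq_bigr => j jc; rewrite ic jc !andbT.
(* Degree sums give 2(n + 1) = 2(n - 1) + 2|E0|: once for [c] itself, once for its edges seen from
   the other ends. *)
have e02 : #|edges e0| = 2%N.
  have := handshake sym_e irr_e; have := handshake sym0 irr0.
  rewrite (bigD1 c) //= deg0c add0n => E0.
  rewrite (bigD1 c) //= degc ne (eq_bigr _ deg0).
  rewrite (eq_bigr (fun i => 1 + deg e0 i)%N) // big_split /= E0.
  by rewrite sum1_card cardC1 card_ord /GRing.add /=; lia.
have /cards2P[[a b] [[a' b'] [pq E0]]] : #|edges e0| == 2%N by rewrite e02.
have inE0 u v : e0 u v && (u < v)%N = (((u, v) == (a, b)) || ((u, v) == (a', b'))).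
  by rewrite -in_set2 -E0 inE.
have [ab ab'] : (a < b)%N /\ (a' < b')%N.
  have := inE0 a b; have := inE0 a' b'; rewrite !eqxx ?orbT /=.
  by move=> /andP[_ ->] /andP[_ ->].
have e0E x y : e0 x y = [|| (x == a) && (y == b), (x == b) && (y == a),
                            (x == a') && (y == b') | (x == b') && (y == a')].
  have mem (u v : 'I_n) : (u < v)%N ->
      e0 u v = (u == a) && (v == b) || (u == a') && (v == b').
    move=> uv; have := inE0 u v; rewrite uv andbT => ->.
    by rewrite !xpair_eqE.
  have swap (s t u v : 'I_n) : (s < t)%N -> (u < v)%N -> (u == t) && (v == s) = false.
    move=> st uv; apply/negP => /andP[/eqP uE /eqP vE].
    by move: uv; rewrite uE vE ltnNge (ltnW st).
  case: (ltngtP x y) => [xy|yx|/val_inj xy].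
  - by rewrite mem // (swap a b) // (swap a' b') // orbF.
  - by rewrite sym0 mem // (andbC (y == a)) (andbC (y == a'))
      [(x == a) && _]andbC (swap a b y x) //
      [(x == a') && _]andbC (swap a' b' y x) // !orbF.
  - rewrite xy irr0; apply/esym/negP.
    by case/or4P => /andP[/eqP-> /eqP h]; move: ab ab'; rewrite h ltnn.
have nac u v : e0 u v -> (u != c) && (v != c) by case/and3P=> _ -> ->.
have /andP[ac bc] : (a != c) && (b != c) by apply: nac; rewrite e0E !eqxx.
have /andP[ac' bc'] : (a' != c) && (b' != c) by apply: nac; rewrite e0E !eqxx !orbT.
have e0e u v : u != c -> v != c -> e u v = e0 u v by rewrite /e0 => -> ->; rewrite !andbT.
have ltF (u v : 'I_n) : (u < v)%N -> (u == v = false) * (v == u = false).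
  by move=> uv; split; apply/negP => /eqP h; move: uv; rewrite h ltnn.
(* Were the two edges disjoint, [a] and [a'] would share the neighbour [c] and have private
   neighbours [b] and [b'], against nestedness. *)
have share : [|| a == a', a == b', b == a' | b == b'].
  apply/negPn/negP; rewrite !negb_or => /and4P[aa' nab' ba' bb'].
  have : e a b' || (b' == a).
    apply: (nest a a' aa' _ b b') => //.
    - by right; exists c; rewrite sym_e dom // sym_e dom.
    - by rewrite e0e // e0E !eqxx.
    - by rewrite e0e // e0E !(eq_sym a') (negbTE aa') (negbTE ba') (negbTE bb')
        (eq_sym b) (ltF a b) // ?andbF.
    - by rewrite e0e // e0E !eqxx !orbT.
  by rewrite e0e // e0E !(eq_sym b') (negbTE bb') (negbTE nab') (negbTE aa')
    ?(ltF _ _ ab) ?andbF.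
(* [s] is the shared end and [t1], [t2] are the other ends; the four cases say which ends
   coincide. *)
have [s [t1 [t2 [us e0S]]]] : exists s t1 t2, uniq [:: c; s; t1; t2] /\
    forall x y, e0 x y = (x == s) && ((y == t1) || (y == t2)) ||
                         (y == s) && ((x == t1) || (x == t2)).
  have tauto u v w (x y : 'I_n) : [|| (x == u) && (y == v), (x == v) && (y == u),
       (x == u) && (y == w) | (x == w) && (y == u)] =
     (x == u) && ((y == v) || (y == w)) || (y == u) && ((x == v) || (x == w)).
    by case: (x == u); case: (x == v); case: (x == w);
       case: (y == u); case: (y == v); case: (y == w).
  case/or4P: share => /eqP h.
  - exists a, b, b'; split.
      rewrite /= !inE !(eq_sym c) !negb_or ac bc bc' (ltF _ _ ab) h (ltF _ _ ab') /= andbT.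
      by apply: contraNneq pq => h'; rewrite h h'.
    by move=> x y; rewrite e0E -h tauto.
  - exists a, b, a'; split.
      rewrite /= !inE !(eq_sym c) !negb_or ac bc ac' (ltF _ _ ab) h (ltF _ _ ab') /= andbT.
      by rewrite (ltF a' b) // (ltn_trans ab') // -h.
    by move=> x y; rewrite e0E -h -tauto; congr [|| _, _ | _]; rewrite orbC.
  - exists b, a, b'; split.
      rewrite /= !inE !(eq_sym c) !negb_or ac bc bc' (ltF _ _ ab) h (ltF _ _ ab') /= andbT.
      by rewrite (ltF a b') // (ltn_trans ab) // h.
    by move=> x y; rewrite e0E -h -tauto !orbA; congr (_ || _ || _); rewrite orbC.
  - exists b, a, a'; split.
      rewrite /= !inE !(eq_sym c) !negb_or ac bc ac' (ltF _ _ ab) h (ltF _ _ ab') /= andbT.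
      by apply: contraNneq pq => h'; rewrite h h'.
    by move=> x y; rewrite e0E -h -tauto !orbA
      [_ || (x == b) && (y == a)]orbC -!orbA; do 2! congr (_ || _); rewrite orbC.
pose o i (H : (i < 4)%N) := Ordinal (leq_trans H n4).
pose o0 := @o 0 isT; pose o1 := @o 1 isT; pose o2 := @o 2 isT; pose o3 := @o 3 isT.
(* Sends [c], [s], [t1], [t2] to 0, 1, 2, 3. The other vertices are adjacent to [c] only, so their
   labels are arbitrary. *)
have [h] := @perm_map_seq _ _ [:: o0; o1; o2; o3] us isT erefl.
case=> hc hs ht1 ht2; exists h => x y.
rewrite /B1.
have E (j : 'I_n) k : h k = j -> (fun x => (val (h x) == val j)) =1 (fun x => x == k).
  by move=> hk z; rewrite -hk val_eqE (inj_eq perm_inj).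
rewrite val_eqE (inj_eq perm_inj).
rewrite -[0%N]/(val o0) -[1%N]/(val o1) -[2%N]/(val o2) -[3%N]/(val o3).
rewrite !(E _ _ hc) !(E _ _ hs) !(E _ _ ht1) !(E _ _ ht2).
have [->|xy] := eqVneq x y; first by rewrite irr_e.
have [xE|xc] /= := eqVneq x c; first by rewrite xE dom // -xE eq_sym.
have [yE|yc] /= := eqVneq y c; first by rewrite yE sym_e dom // -yE.
by rewrite e0e // e0S.
Qed.

(** * Extremality and uniqueness *)

Theorem theorem5p2 (R : realType) (f : R -> R -> R) (n : nat) :
  propP f -> (6 <= n)%N ->
  forall e : rel 'I_n, bicyclic e -> ~ isomorphic e (@B1 n) ->
  rho (Af f e) < rho (Af f (@B1 n)).
Proof.
move=> Pf n6 e be neB1.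
have improve e1 : bicyclic e1 -> ~ isomorphic e1 (@B1 n) ->
    exists e2 : rel 'I_n, bicyclic e2 /\ rho (Af f e1) < rho (Af f e2).
  move=> b1 n1; apply: contrapT => nimp; apply: n1.
  apply: nested_isomorphic_B1 => // [|u v uv near w z uw vw wv vz]; first by lia.
  apply: contrapT => /negP; rewrite negb_or => /andP[uz zu]; apply: nimp.
  apply: (kelmans_improves Pf b1 uv near); first by exists w; apply/and3P.
  by exists z; apply/and3P.
(* Coding relations as sets of pairs gives a finite type, over which a bicyclic graph of maximal
   [rho] can be chosen. *)
pose rel_of (g : {set 'I_n * 'I_n}) : rel 'I_n := fun x y => (x, y) \in g.
have rel_ofK (e1 : rel 'I_n) : rel_of [set p | e1 p.1 p.2] = e1.
  by apply/funext => x; apply/funext => y; rewrite /rel_of inE.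
pose g0 : {set 'I_n * 'I_n} := finset (fun p => e p.1 p.2).
pose P (g : {set 'I_n * 'I_n}) := `[< bicyclic (rel_of g) >].
pose F (g : {set 'I_n * 'I_n}) := rho (Af f (rel_of g)).
have Pg0 : P g0 by apply/asboolP; rewrite rel_ofK.
case: (arg_maxP F Pg0) => g /asboolP bg gmax.
have gB1 : isomorphic (rel_of g) (@B1 n).
  apply: contrapT => /(improve _ bg)[e2 [b2]].
  rewrite ltNge => /negP; apply.
  have := gmax (finset (fun p => e2 p.1 p.2)); rewrite /F rel_ofK; apply.
  by apply/asboolP; rewrite rel_ofK.
rewrite -(rho_isomorphic f gB1).
(* Strictness comes from improving [e] once before comparing with the maximum. *)
have [e2 [b2 lt2]] := improve e be neB1; apply: lt_le_trans lt2 _.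
have := gmax (finset (fun p => e2 p.1 p.2)); rewrite /F rel_ofK; apply.
by apply/asboolP; rewrite rel_ofK.
Qed.
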